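(* Let $n = 2^a m$, where $a \geq 0$ is an integer and $m > 1$ is an odd integer. If $2^{a+1} > \sigma(m)$, then \[ p_{\mathrm{dd}}(n) \geq \left\lfloor \frac{2^{a+1} - 1}{\sigma(m) - 1} \right\rfloor^{d(m) - 1}. \]
   Context: For a positive integer $n$, $p_{\mathrm{dd}}(n)$ is the number of partitions of $n$ into distinct divisors of $n$, i.e. the number of sets of positive divisors of $n$ whose elements sum to $n$ (the divisor $n$ itself is allowed). $\sigma(m)$ is the sum of the positive divisors of $m$, and $d(m)$ is the number of positive divisors of $m$. *)

(* Defs.v *)
From mathcomp Require Import all_boot.

Set Implicit Arguments.
Unset Strict Implicit.
Unset Printing Implicit Defensive.

(* A set of positive divisors of n > 0 is a subset of {0, ..., n} whose
   elements all divide n: every divisor of n is at most n, and 0 does not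
   divide n. *)
Definition p_dd (n : nat) : nat :=
  #|[set A : {set 'I_n.+1} |
      [forall d in A, d %| n] && (\sum_(d in A) d == n)]|.

Definition sigma (m : nat) : nat := \sum_(d <- divisors m) d.

Definition num_divisors (m : nat) : nat := size (divisors m).

(* Main.v *)
Require Import Defs.
From mathcomp Require Import all_boot.
From mathcomp Require Import zify.

(** The divisors of [n = 2 ^ a * m] are the numbers [2 ^ i * d] with [i <= a]
    and [d] a divisor of [m].  Choosing, for a fixed [d], which of the
    [2 ^ i * d] are taken amounts to writing in binary a coefficient
    [c d < 2 ^ a.+1].  Sets of divisors of [n] with sum [n] therefore
    correspond to the solutions of [\sum_(d %| m) c d * d = n] with all
    coefficients below [2 ^ a.+1] ([sum_divisor_set], [divisor_set_inj]).

    It remains to exhibit enough solutions.  Put [s = sigma m - 1], the sum of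
    the divisors [d > 1] of [m], then [K = (2 ^ a.+1 - 1) %/ s] and
    [q = n %/ s].  For each divisor [d > 1] choose freely a defect [e d < K],
    and take [c d = q - e d].  The coefficient of the divisor 1 is then forced:
    [c 1 = n - \sum_(d > 1) (q - e d) * d = n %% s + \sum_(d > 1) e d * d],
    which lies between [0] and [(s - 1) + (K - 1) * s < 2 ^ a.+1], so it is
    always admissible ([defect_solution]).  Since [m <= s], moreover
    [q <= 2 ^ a]; and since [K * s < 2 ^ a.+1 <= n], [K <= q], so the [q - e d]
    are admissible too and determine [e].  There are [K ^ (num_divisors m - 1)]
    choices of [e]. *)

(** * Divisors of a power of two times an odd number *)

Lemma big_divisors (F : nat -> nat) (m : nat) : 0 < m ->
  \sum_(d <- divisors m) F d = \sum_(d < m.+1 | d %| m) F d.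
Proof.
move=> m0; rewrite -(big_mkord (fun d => d %| m) F) -[RHS]big_filter.
apply: perm_big; apply: uniq_perm; first exact: divisors_uniq.
  by rewrite filter_uniq // iota_uniq.
move=> d; rewrite mem_filter mem_index_iota /= -dvdn_divisors // ltnS.
by case: (boolP (d %| m)) => // /(dvdn_leq m0) ->.
Qed.

Lemma logn2_pow2_odd (i d : nat) : odd d -> logn 2 (2 ^ i * d) = i.
Proof.
move=> od; rewrite lognM ?expn_gt0 ?(odd_gt0 od) // pfactorK //.
by rewrite logn_coprime ?addn0 // coprime2n.
Qed.

Lemma oddpart_pow2_odd (i d : nat) : odd d -> (2 ^ i * d)`_2^' = d.
Proof.
move=> od; rewrite partnM ?expn_gt0 ?(odd_gt0 od) // partnX.
rewrite (part_p'nat (n := 2)) ?exp1n ?mul1n; last by rewrite pnatNK pnat_id.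
by rewrite part_pnat_id // p'natE // dvdn2 od.
Qed.

Lemma dvdn_pow2_mul (a m i d : nat) :
  i < a.+1 -> d %| m -> 2 ^ i * d %| 2 ^ a * m.
Proof. by move=> ia dm; rewrite dvdn_mul // dvdn_exp2l. Qed.

Lemma big_divisors_pow2_odd (F : nat -> nat) (a m : nat) : odd m ->
  \sum_(x <- divisors (2 ^ a * m)) F x =
  \sum_(d <- divisors m) \sum_(i < a.+1) F (2 ^ i * d).
Proof.
move=> om; have m0 := odd_gt0 om.
have n0 : 0 < 2 ^ a * m by rewrite muln_gt0 expn_gt0.
pose s := [seq 2 ^ i * d | d <- divisors m, i <- index_iota 0 a.+1].
have -> : \sum_(x <- divisors (2 ^ a * m)) F x = \sum_(x <- s) F x.
  apply: perm_big; apply: uniq_perm; first exact: divisors_uniq.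
    apply: allpairs_uniq; rewrite ?divisors_uniq ?iota_uniq //.
    move=> _ _ /allpairsP[[d i] [dm _ ->]] /allpairsP[[e j] [em _ ->]].
    rewrite /= in dm em *; rewrite -!dvdn_divisors // in dm em.
    have od := dvdn_odd dm om; have oe := dvdn_odd em om.
    move=> /= E; congr (_, _).
      by rewrite -(oddpart_pow2_odd i d od) E oddpart_pow2_odd.
    by rewrite -(logn2_pow2_odd i d od) E logn2_pow2_odd.
  move=> x; rewrite -dvdn_divisors //; apply/idP/allpairsP.
    move=> xn; exists (x`_2^', logn 2 x) => /=; split.
    - rewrite -dvdn_divisors // -(oddpart_pow2_odd a m om).
      exact: partn_dvd.
    - rewrite mem_index_iota /= ltnS -(logn2_pow2_odd a m om).
      exact: dvdn_leq_log.
    - by rewrite -p_part partnC // (dvdn_gt0 n0).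
  case=> -[d i] /= []; rewrite -dvdn_divisors // mem_index_iota /= => dm ia ->.
  exact: dvdn_pow2_mul.
by rewrite big_allpairs_dep; apply: eq_bigr => d _; rewrite big_mkord.
Qed.

(** * Sets of divisors as coefficients in binary *)

Lemma binary_expansion (a c : nat) : c < 2 ^ a ->
  \sum_(i < a) odd (c %/ 2 ^ i) * 2 ^ i = c.
Proof.
elim: a c => [|a IH] c; first by rewrite big_ord0; case: c.
move=> ca; rewrite big_ord_recl expn0 divn1 muln1.
under eq_bigr => i _ do rewrite /= expnS divnMA divn2 mulnCA.
rewrite -big_distrr /= IH; first lia.
by move: ca; rewrite expnS; lia.
Qed.

(** If [x = 2 ^ i * d] with [d] odd, then [x`_2^'] is [d] and [logn 2 x] is [i],
    so that membership of [x] is the binary digit of rank [i] of [c d]. *)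
Definition divisor_set (n : nat) (c : nat -> nat) : {set 'I_n.+1} :=
  [set x : 'I_n.+1 | (x %| n) && odd (c (x`_2^') %/ 2 ^ logn 2 x)].

Lemma sum_divisor_set (a m : nat) (c : nat -> nat) : odd m ->
    (forall d, d %| m -> c d < 2 ^ a.+1) ->
  \sum_(x in divisor_set (2 ^ a * m) c) x = \sum_(d <- divisors m) c d * d.
Proof.
move=> om c_lt; have m0 := odd_gt0 om.
pose F x := odd (c (x`_2^') %/ 2 ^ logn 2 x) * x.
have -> : \sum_(x in divisor_set (2 ^ a * m) c) x =
          \sum_(x < (2 ^ a * m).+1 | x %| 2 ^ a * m) F x.
  rewrite big_mkcond [RHS]big_mkcond; apply: eq_bigr => x _.
  by rewrite inE /F; case: (_ %| _) => //=; case: odd; rewrite ?mul1n.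
rewrite -big_divisors ?muln_gt0 ?expn_gt0 // big_divisors_pow2_odd //.
apply: eq_big_seq => d; rewrite -dvdn_divisors // => dm.
have od := dvdn_odd dm om.
rewrite -[in RHS](binary_expansion _ _ (c_lt d dm)) big_distrl.
apply: eq_bigr => i _; rewrite /F oddpart_pow2_odd // logn2_pow2_odd //.
by rewrite mulnA.
Qed.

Lemma divisor_set_inj (a m : nat) (c c' : nat -> nat) : odd m ->
    (forall d, d %| m -> c d < 2 ^ a.+1) ->
    (forall d, d %| m -> c' d < 2 ^ a.+1) ->
    divisor_set (2 ^ a * m) c = divisor_set (2 ^ a * m) c' ->
  forall d, d %| m -> c d = c' d.
Proof.
move=> om c_lt c'_lt E d dm; have od := dvdn_odd dm om.
rewrite -(binary_expansion _ _ (c_lt d dm)) -(binary_expansion _ _ (c'_lt d dm)).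
apply: eq_bigr => i _; congr (nat_of_bool _ * _).
have xn := dvdn_pow2_mul a m i d (ltn_ord i) dm.
have x_le : 2 ^ i * d < (2 ^ a * m).+1.
  by rewrite ltnS dvdn_leq // muln_gt0 expn_gt0 (odd_gt0 om).
move/setP/(_ (Ordinal x_le)): E.
by rewrite !inE /= xn oddpart_pow2_odd // logn2_pow2_odd.
Qed.

(** * Solutions with prescribed defects *)

(** The sum [s] of the [d i], all of them taken [q = n %/ s] times, misses [n]
    by [n %% s] only; lowering the multiplicities by less than [K] raises this
    gap to less than [K * s]. *)
Lemma defect_solution (I : finType) (D : {pred I}) (d e : I -> nat) (n K : nat)
    (s := \sum_(i in D) d i) (S := \sum_(i in D) (n %/ s - e i) * d i) :
    0 < s -> K <= n %/ s -> (forall i, e i < K) ->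
  S <= n /\ n - S < K * s.
Proof.
move=> s0 Kq eK.
have SE : S + \sum_(i in D) e i * d i = n %/ s * s.
  rewrite -big_split big_distrr /=; apply: eq_bigr => i _.
  by rewrite -mulnDl subnK // (leq_trans (ltnW (eK i)) Kq).
have eS : \sum_(i in D) e i * d i <= K.-1 * s.
  rewrite big_distrr /=; apply: leq_sum => i _; rewrite leq_mul2r.
  by apply/orP; right; have := eK i; lia.
have := divn_eq n s; have := ltn_pmod n s0.
case: K {Kq} eK eS => [|k] eK eS; last by rewrite mulSn; lia.
have [i _|D0] := pickP D; first by have := eK i.
by move: s0; rewrite /s big_pred0.
Qed.

Theorem theorem4 (n a m : nat) (hm : 1 < m) (hodd : odd m)
    (hn : n = 2 ^ a * m) (hsigma : sigma m < 2 ^ a.+1) :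
  ((2 ^ a.+1 - 1) %/ (sigma m - 1)) ^ (num_divisors m - 1) <= p_dd n.
Proof.
have m0 := ltnW hm.
pose D := [pred d : 'I_m.+1 | (d %| m) && (d != 1 :> nat)].
have one_lt : 1 < m.+1 by [].
pose one := Ordinal one_lt.
have split1 F : \sum_(d <- divisors m) F d = F 1 + \sum_(d in D) F d.
  by rewrite big_divisors // (bigD1 one) ?dvd1n //=.
have sE : sigma m - 1 = \sum_(d in D) d by rewrite /sigma split1 addKn.
have cardD : num_divisors m - 1 = #|D|.
  by rewrite /num_divisors -sum1_size split1 addKn sum1_card.
have m_le_s : m <= sigma m - 1.
  rewrite sE (bigD1 ord_max) /= ?leq_addr // unfold_in /= dvdnn /=; lia.
set s := sigma m - 1 in sE m_le_s *.
have s0 : 0 < s by lia.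
set K := _ %/ s.
have Ks : K * s <= 2 ^ a.+1 - 1 by exact: leq_trunc_div.
have K0 : 0 < K by rewrite divn_gt0 // /s; lia.
have pow_le_n : 2 ^ a.+1 <= n by rewrite hn expnSr leq_mul2l hm orbT.
set q := n %/ s.
have Kq : K <= q by rewrite leq_divRL //; lia.
have q_le : q <= 2 ^ a.
  by apply: leq_trans (leq_div2l n m0 m_le_s) _; rewrite hn mulnK.
have q_lt : q < 2 ^ a.+1 by rewrite expnS; have := expn_gt0 2 a; lia.
clearbody K; case: K K0 Ks Kq => // k _ Ks Kq.
pose rest (e : {ffun 'I_m.+1 -> 'I_k.+1}) := \sum_(d in D) (q - e d) * d.
pose c (e : {ffun 'I_m.+1 -> 'I_k.+1}) (d : nat) :=
  if d == 1 then n - rest e else q - e (inord d).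
have restP e : rest e <= n /\ n - rest e < k.+1 * s.
  have := @defect_solution _ D (@nat_of_ord _) (fun d => e d) n k.+1.
  by rewrite -sE; apply.
have c_lt e d : d %| m -> c e d < 2 ^ a.+1.
  by move=> _; rewrite /c; case: ifP => _; have [] := restP e; lia.
have sum_c e : \sum_(d <- divisors m) c e d * d = n.
  rewrite split1 {1}/c eqxx muln1.
  have -> : \sum_(d in D) c e d * d = rest e.
    apply: eq_bigr => d /andP[_ d1].
    by rewrite /c (negbTE d1) inord_val.
  by rewrite subnK //; have [] := restP e.
(* Defects are put to 0 outside [D], so that distinct [e] give distinct [c]. *)
pose E := [set e | e \in pffun_on (ord0 : 'I_k.+1) D predT].
have -> : k.+1 ^ (num_divisors m - 1) = #|E|.
  by rewrite cardsE card_pffun_on card_ord cardD.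
rewrite -(card_in_imset (f := fun e => divisor_set n (c e))); last first.
  move=> e e'; rewrite !inE => /pffun_onP[supp _] /pffun_onP[supp' _] eqA.
  apply/ffunP => d; case: (boolP (d \in D)) => [dD|dND].
    have /andP[dm d1] := dD.
    rewrite hn in eqA.
    have := divisor_set_inj a m _ _ hodd (c_lt e) (c_lt e') eqA d dm.
    rewrite /c (negbTE d1) inord_val => E1; apply: val_inj; move: E1.
    by case: (e d) => x x_lt; case: (e' d) => y y_lt /=; lia.
  have zero f : ord0.-support f \subset D -> f d = ord0.
    by move/supportP; apply.
  by rewrite !zero.
apply/subset_leq_card/subsetP => _ /imsetP[e _ ->].
rewrite inE; apply/andP; split.
  by apply/forall_inP => x; rewrite inE => /andP[].
by have := sum_divisor_set a m (c e) hodd (c_lt e); rewrite -hn sum_c => ->.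
Qed.
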